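(* There is no algorithm that, given a finite set $\Sigma$ of sp-implications, decides whether the spi-logic $\mathsf{SPi}+\Sigma$ is complete. Likewise, there is no algorithm that, given a finite set $\Sigma$ of sp-implications, decides whether $\mathsf{SPi}+\Sigma$ is complex.
   Context: Signatures are sets $\mathcal R$ of relation symbols with diamonds $\Diamond_R$ (multimodal; the sets $\Sigma$ may use any finitely many diamonds). Sp-formulas: built from propositional variables and $\top$ by $\wedge$ and the $\Diamond_R$; sp-implications $\sigma\to\tau$. A SLO is an algebra $(A,\wedge,\top,\Diamond_R)_R$ with $(A,\wedge,\top)$ a meet-semilattice with top and each $\Diamond_R$ monotone; it validates $\sigma\to\tau$ if $\sigma[\mathfrak a]\le\tau[\mathfrak a]$ for all valuations. Frames $(W,R^{\mathfrak F})_R$ with standard Kripke semantics. $\Sigma\models_{\mathsf{Kr}}\iota$ (resp. $\models_{\mathsf{SLO}}$): $\iota$ valid in every frame (resp. SLO) validating $\Sigma$. The spi-logic $\mathsf{SPi}+\Sigma=\{\iota\mid\Sigma\models_{\mathsf{SLO}}\iota\}$ is complete if $\Sigma\models_{\mathsf{Kr}}\iota\iff\Sigma\models_{\mathsf{SLO}}\iota$ for all sp-implications $\iota$. For a frame $\mathfrak F$, $\mathfrak F^\star=(2^W,\cap,W,\Diamond_R^+)_R$ with $\Diamond_R^+X=\{w\mid\exists v\in X,(w,v)\in R^{\mathfrak F}\}$; a spi-logic $L$ is complex if every SLO validating $L$ embeds (injectively, preserving $\wedge,\top,\Diamond_R$) into $\mathfrak F^\star$ for some frame $\mathfrak F$ validating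 $L$. *)

(* Defs.v *)
From HB Require Import structures.
From mathcomp Require Import all_boot.

Set Implicit Arguments.
Unset Strict Implicit.
Unset Printing Implicit Defensive.

Inductive spf : Type :=
| SVar : nat -> spf
| STop : spf
| SAnd : spf -> spf -> spf
| SDia : nat -> spf -> spf.

(* an sp-implication  sigma -> tau  *)
Definition spi : Type := (spf * spf)%type.

Fixpoint spf_to_tree (f : spf) : GenTree.tree nat :=
  match f with
  | SVar n => GenTree.Node 0 [:: GenTree.Leaf n]
  | STop => GenTree.Node 1 [::]
  | SAnd a b => GenTree.Node 2 [:: spf_to_tree a; spf_to_tree b]
  | SDia r a => GenTree.Node 3 [:: GenTree.Leaf r; spf_to_tree a]
  end.

Fixpoint spf_of_tree (t : GenTree.tree nat) : option spf :=
  match t with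
  | GenTree.Node 0 [:: GenTree.Leaf n] => Some (SVar n)
  | GenTree.Node 1 [::] => Some STop
  | GenTree.Node 2 [:: a; b] =>
      match spf_of_tree a, spf_of_tree b with
      | Some x, Some y => Some (SAnd x y)
      | _, _ => None
      end
  | GenTree.Node 3 [:: GenTree.Leaf r; a] => omap (SDia r) (spf_of_tree a)
  | _ => None
  end.

Lemma spf_treeK : pcancel spf_to_tree spf_of_tree.
Proof. by elim=> //= [a -> b ->|r a ->]. Qed.

HB.instance Definition _ := Equality.copy spf (pcan_type spf_treeK).
HB.instance Definition _ := Choice.copy spf (pcan_type spf_treeK).
HB.instance Definition _ := Countable.copy spf (pcan_type spf_treeK).

Record SLO : Type := {
  slo_car : Type;
  slo_meet : slo_car -> slo_car -> slo_car;
  slo_top : slo_car;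
  slo_dia : nat -> slo_car -> slo_car;
  slo_meetA : forall x y z, slo_meet x (slo_meet y z) = slo_meet (slo_meet x y) z;
  slo_meetC : forall x y, slo_meet x y = slo_meet y x;
  slo_meetxx : forall x, slo_meet x x = x;
  slo_meetT : forall x, slo_meet x slo_top = x;
  slo_dia_mono : forall r x y,
      slo_meet x y = x -> slo_meet (slo_dia r x) (slo_dia r y) = slo_dia r x
}.

Definition slo_le (A : SLO) (x y : slo_car A) : Prop := slo_meet x y = x.

Fixpoint slo_eval (A : SLO) (v : nat -> slo_car A) (f : spf) : slo_car A :=
  match f with
  | SVar n => v n
  | STop => slo_top A
  | SAnd a b => slo_meet (slo_eval v a) (slo_eval v b)
  | SDia r a => slo_dia r (slo_eval v a)
  end.

Definition slo_valid (A : SLO) (i : spi) : Prop :=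
  forall v : nat -> slo_car A, slo_le (slo_eval v i.1) (slo_eval v i.2).

Definition slo_conseq (Sigma : seq spi) (i : spi) : Prop :=
  forall A : SLO, (forall s, s \in Sigma -> slo_valid A s) -> slo_valid A i.

Definition spi_logic (Sigma : seq spi) : spi -> Prop := slo_conseq Sigma.

Record frame : Type := {
  world : Type;
  frel : nat -> world -> world -> Prop
}.
Arguments frel : clear implicits.

Fixpoint kr_sat (F : frame) (V : nat -> world F -> Prop) (w : world F) (f : spf)
  : Prop :=
  match f with
  | SVar n => V n w
  | STop => True
  | SAnd a b => kr_sat V w a /\ kr_sat V w b
  | SDia r a => exists u : world F, frel F r w u /\ kr_sat V u a
  end.

Definition frame_valid (F : frame) (i : spi) : Prop :=
  forall (V : nat -> world F -> Prop) (w : world F), kr_sat V w i.1 -> kr_sat V w i.2.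

Definition kr_conseq (Sigma : seq spi) (i : spi) : Prop :=
  forall F : frame, (forall s, s \in Sigma -> frame_valid F s) -> frame_valid F i.

Definition complete (Sigma : seq spi) : Prop :=
  forall i : spi, kr_conseq Sigma i <-> slo_conseq Sigma i.

(* The complex algebra F^* : subsets of W (up to extensional equality),
   with intersection, W, and the diamonds Diamond_R^+. *)
Definition cx_dia (F : frame) (r : nat) (X : world F -> Prop) : world F -> Prop :=
  fun w => exists v, X v /\ frel F r w v.

Definition set_eq (W : Type) (X Y : W -> Prop) : Prop := forall w, X w <-> Y w.

Definition slo_embedding (A : SLO) (F : frame) (h : slo_car A -> world F -> Prop)
  : Prop :=
  [/\ (forall x y, set_eq (h x) (h y) -> x = y),
      (forall x y, set_eq (h (slo_meet x y)) (fun w => h x w /\ h y w)),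
      set_eq (h (slo_top A)) (fun _ => True) &
      (forall r x, set_eq (h (slo_dia r x)) (cx_dia r (h x)))].

Definition slo_validates_logic (A : SLO) (L : spi -> Prop) : Prop :=
  forall i, L i -> slo_valid A i.

Definition frame_validates_logic (F : frame) (L : spi -> Prop) : Prop :=
  forall i, L i -> frame_valid F i.

Definition complex (Sigma : seq spi) : Prop :=
  forall A : SLO, slo_validates_logic A (spi_logic Sigma) ->
    exists F : frame, frame_validates_logic F (spi_logic Sigma) /\
      exists h : slo_car A -> world F -> Prop, slo_embedding h.

Inductive prf : Type :=
| PZero : prf
| PSucc : prf
| PProj : nat -> prf
| PComp : prf -> seq prf -> prf
| PPrim : prf -> prf -> prf
| PMu : prf -> prf.

Inductive peval : prf -> seq nat -> nat -> Prop :=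
| ev_zero args : peval PZero args 0
| ev_succ x : peval PSucc [:: x] x.+1
| ev_proj i args : (i < size args)%N -> peval (PProj i) args (nth 0 args i)
| ev_comp f gs args ys y :
    pevals gs args ys -> peval f ys y -> peval (PComp f gs) args y
| ev_prim0 f g args y : peval f args y -> peval (PPrim f g) (0 :: args) y
| ev_primS f g n args r y :
    peval (PPrim f g) (n :: args) r -> peval g [:: n, r & args] y ->
    peval (PPrim f g) (n.+1 :: args) y
| ev_mu f args n :
    peval f (n :: args) 0 ->
    (forall m, (m < n)%N -> exists k, peval f (m :: args) k.+1) ->
    peval (PMu f) args n
with pevals : seq prf -> seq nat -> seq nat -> Prop :=
| evs_nil args : pevals [::] args [::]
| evs_cons g gs args y ys :
    peval g args y -> pevals gs args ys -> pevals (g :: gs) args (y :: ys).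

Definition rec_decidable (T : countType) (P : T -> Prop) : Prop :=
  exists p : prf, forall x : T,
    (P x -> peval p [:: pickle x] 1) /\ (~ P x -> peval p [:: pickle x] 0).

(* Main.v *)
(** Partial recursive functions are evaluated by a deterministic rewriting
    machine whose configurations are binary trees.  A tree is read as an
    sp-formula, "configuration [c] is reached" as [⊤ ≤ ◇₀c], and a rewrite rule
    [l ⇒ r], applied at the root only, as [◇₀l → ◇₀r].  To these axioms and to
    [⊤ → ◇₀start] we add [◇₁p → p] and, for each of the five diamonds [◇] in
    use, [◇₀halt ∧ p → ◇p] and [◇₀halt ∧ ◇p → p].

    If the machine halts, the five diamonds are the identity in every SLO of the
    logic, and the logic is complex, hence complete.  If it does not, let [◇₀X]
    say that [X] contains a reachable configuration, and let [◇₁X] be everything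
    or nothing according to whether [X] is everything.  On the powerset of the
    set of trees this gives an SLO that validates the axioms and refutes
    [p ∧ ◇₁⊤ → ◇₁p].  Frames for [◇₁p → p] have [R₁] included in the diagonal, so
    they validate this implication and the logic is incomplete.

    Hence a property of [Σ] lying between complexity and completeness is
    undecidable: run the machine on a purported decider, applied to the very
    axiom system that describes this computation.  A decider being total, only
    the forward simulation and the determinism of the machine are needed. *)

From HB Require Import structures.
From Stdlib Require Import Relation_Operators Operators_Properties.
From mathcomp Require Import all_boot boolp.
Require Import Defs.

Set Implicit Arguments.
Unset Strict Implicit.
Unset Printing Implicit Defensive.

(** * Complex algebras *)

Section SLOOrder.
Variable A : SLO.
Implicit Types x y z : slo_car A.

Lemma slo_le_refl x : slo_le x x.
Proof. exact: slo_meetxx. Qed.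

Lemma slo_le_trans y x z : slo_le x y -> slo_le y z -> slo_le x z.
Proof. by rewrite /slo_le => xy yz; rewrite -xy -slo_meetA yz. Qed.

Lemma slo_le_anti x y : slo_le x y -> slo_le y x -> x = y.
Proof. by move=> xy yx; rewrite -xy slo_meetC. Qed.

Lemma slo_meet_top x : slo_meet (slo_top A) x = x.
Proof. by rewrite slo_meetC slo_meetT. Qed.

Lemma slo_meet_lel x y : slo_le (slo_meet x y) x.
Proof. by rewrite /slo_le slo_meetC slo_meetA slo_meetxx. Qed.

Lemma slo_le_meet z x y :
  slo_le z (slo_meet x y) <-> slo_le z x /\ slo_le z y.
Proof.
split=> [zxy|[zx zy]]; last by rewrite /slo_le slo_meetA zx.
split; apply: slo_le_trans zxy _; first exact: slo_meet_lel.
by rewrite slo_meetC; apply: slo_meet_lel.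
Qed.

End SLOOrder.

Definition slo_validates (A : SLO) (Sigma : seq spi) : Prop :=
  forall s, s \in Sigma -> slo_valid A s.

Definition frame_validates (F : frame) (Sigma : seq spi) : Prop :=
  forall s, s \in Sigma -> frame_valid F s.

Section PowersetSLO.
Variables (W : Type) (dia : nat -> (W -> Prop) -> W -> Prop).
Hypothesis dia_mono : forall r (X Y : W -> Prop),
  (forall w, X w -> Y w) -> forall w, dia r X w -> dia r Y w.

Definition powerset_SLO : SLO.
Proof.
refine (@Build_SLO (W -> Prop) (fun X Y w => X w /\ Y w) (fun=> True) dia
          _ _ _ _ _).
- by move=> X Y Z; apply/predeqP => w; tauto.
- by move=> X Y; apply/predeqP => w; tauto.
- by move=> X; apply/predeqP => w; tauto.
- by move=> X; apply/predeqP => w; tauto.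
- move=> r X Y XY; apply/predeqP => w; split=> [[]//|dX]; split=> //.
  by apply: dia_mono dX => u; rewrite -XY => -[].
Defined.

Lemma powerset_SLO_le (X Y : W -> Prop) :
  @slo_le powerset_SLO X Y <-> forall w, X w -> Y w.
Proof.
split=> [XY w|XY]; first by rewrite -XY => -[].
by apply/predeqP => w; split=> [[]//|Xw]; split=> //; apply: XY.
Qed.

End PowersetSLO.

Lemma cx_dia_mono (F : frame) (r : nat) (X Y : world F -> Prop) :
  (forall w, X w -> Y w) -> forall w, cx_dia r X w -> cx_dia r Y w.
Proof. by move=> XY w [u [/XY Yu Rwu]]; exists u. Qed.

Definition complex_algebra (F : frame) : SLO := powerset_SLO (@cx_dia_mono F).

Lemma complex_algebra_embedding (F : frame) :
  @slo_embedding (complex_algebra F) F id.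
Proof. by split=> // X Y /predeqP. Qed.

Section Embedding.
Variables (A : SLO) (F : frame) (h : slo_car A -> world F -> Prop).
Hypothesis h_emb : slo_embedding h.

Lemma slo_embedding_eval (v : nat -> slo_car A) (f : spf) (w : world F) :
  h (slo_eval v f) w <-> kr_sat (fun n => h (v n)) w f.
Proof.
case: h_emb => _ meetE topE diaE.
elim: f w => [n||f IHf g IHg|r f IHf] w /=.
- by split.
- exact: topE.
- by rewrite meetE IHf IHg.
- by rewrite diaE; split=> -[u [? ?]]; exists u; split=> //; apply/IHf.
Qed.

Lemma slo_embedding_valid (i : spi) : frame_valid F i -> slo_valid A i.
Proof.
case: h_emb => inj meetE _ _ Fi v; apply: inj => w; rewrite meetE.
split=> [[]//|hw]; split=> //.
exact/slo_embedding_eval/Fi/slo_embedding_eval.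
Qed.

End Embedding.

Lemma complex_algebra_valid (F : frame) (i : spi) :
  slo_valid (complex_algebra F) i <-> frame_valid F i.
Proof.
have emb := complex_algebra_embedding F.
split=> [Ai V w|]; last exact: slo_embedding_valid emb _.
have /powerset_SLO_le le_i := Ai V.
by move/(slo_embedding_eval emb)/le_i/(slo_embedding_eval emb).
Qed.

Lemma slo_conseq_kr_conseq (Sigma : seq spi) (i : spi) :
  slo_conseq Sigma i -> kr_conseq Sigma i.
Proof.
move=> con F FS; apply/complex_algebra_valid/con => s /FS.
by move/complex_algebra_valid.
Qed.

Lemma frame_validates_spi_logic (F : frame) (Sigma : seq spi) :
  frame_validates F Sigma -> frame_validates_logic F (spi_logic Sigma).
Proof. by move=> FS i /slo_conseq_kr_conseq; apply. Qed.

Lemma complex_complete (Sigma : seq spi) : complex Sigma -> complete Sigma.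
Proof.
move=> cx i; split=> [con A AS|]; last exact: slo_conseq_kr_conseq.
have [|F [FL [h h_emb]]] := cx A; first by move=> j; apply.
apply: (slo_embedding_valid h_emb); apply: con => s sS.
by apply: FL => B; apply.
Qed.

(* The worlds stand for the principal filters of [A]. *)
Definition element_frame (A : SLO) (D : pred nat) : frame :=
  Build_frame (fun r (w u : slo_car A) =>
                 if D r then w = u else slo_le w (slo_dia r u)).

Lemma element_frame_embedding (A : SLO) (D : pred nat) :
  (forall r (x : slo_car A), D r -> slo_dia r x = x) ->
  @slo_embedding A (element_frame A D) (fun x w => slo_le w x).
Proof.
move=> dia_id; split=> [x y xy|x y w||r x w].
- by apply: slo_le_anti; apply/xy/slo_le_refl.
- exact: slo_le_meet.
- by move=> w; split=> // _; apply: slo_meetT.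
rewrite /cx_dia /=; case Dr: (D r).
  by rewrite dia_id //; split=> [wx|[u [ux ->]]]; first exists w.
split=> [wx|[u [ux wu]]]; first by exists x; split=> //; apply: slo_le_refl.
exact/(slo_le_trans wu)/slo_dia_mono.
Qed.

(** * Root rewriting of binary trees *)

Inductive tree : Type := Var of nat | Leaf | Node of tree & tree.

Lemma tree_comparable : comparable tree.
Proof. by move=> s t; rewrite /decidable; do 2!decide equality. Qed.

HB.instance Definition _ := comparableMixin tree_comparable.

Fixpoint inst (t : nat -> tree) (p : tree) : tree :=
  match p with
  | Var i => t i
  | Leaf => Leaf
  | Node a b => Node (inst t a) (inst t b)
  end.

Fixpoint vars (p : tree) : seq nat :=
  match p with
  | Var i => [:: i]
  | Leaf => [::]
  | Node a b => vars a ++ vars b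
  end.

Definition ground (p : tree) : bool := nilp (vars p).

Lemma ground_node (a b : tree) : ground (Node a b) = ground a && ground b.
Proof. by rewrite /ground /= !/(nilp _) size_cat addn_eq0. Qed.

Lemma eq_in_inst (t u : nat -> tree) (p : tree) :
  {in vars p, t =1 u} <-> inst t p = inst u p.
Proof.
elim: p => [i||a IHa b IHb] /=.
- by split=> [|tu j]; [apply; rewrite mem_head|rewrite inE => /eqP->].
- by [].
split=> [tu|[/IHa ta /IHb tb] i]; last first.
  by rewrite mem_cat => /orP[/ta|/tb].
congr Node; [apply/IHa|apply/IHb] => i i_in; apply: tu.
  by rewrite mem_cat i_in.
by rewrite mem_cat i_in orbT.
Qed.

Lemma inst_Var (p : tree) : inst Var p = p.
Proof. by elim: p => //= a -> b ->. Qed.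

Lemma inst_ground (t : nat -> tree) (p : tree) : ground p -> inst t p = p.
Proof.
by rewrite -[RHS]inst_Var => /nilP p0; apply/eq_in_inst; rewrite p0.
Qed.

Fixpoint overlap (p q : tree) : bool :=
  match p, q with
  | Var _, _ | _, Var _ | Leaf, Leaf => true
  | Node a b, Node c d => overlap a c && overlap b d
  | _, _ => false
  end.

Lemma inst_eq_overlap (t u : nat -> tree) (p q : tree) :
  inst t p = inst u q -> overlap p q.
Proof.
by elim: p q => [//||a IHa b IHb] [|//|c d] //= [/IHa-> /IHb->].
Qed.

Definition rule : Type := (tree * tree)%type.

Definition well_formed (r : rule) : bool :=
  uniq (vars r.1) && all [in vars r.1] (vars r.2).

Section Rewriting.
Variable rs : seq rule.

Definition root_step (c d : tree) : Prop :=
  exists r t, [/\ r \in rs, c = inst t r.1 & d = inst t r.2].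

Definition rewrites : tree -> tree -> Prop := clos_refl_trans tree root_step.

Definition stuck (c : tree) : bool := all (fun r => ~~ overlap r.1 c) rs.

Definition nonoverlapping : bool :=
  pairwise (fun r s : rule => ~~ overlap r.1 s.1) rs.

Lemma stuck_root_step (c d : tree) : stuck c -> ~ root_step c d.
Proof.
move=> /allP stc [r [t [/stc/negP no_overlap Ec _]]]; apply: no_overlap.
by apply: (@inst_eq_overlap t Var); rewrite inst_Var.
Qed.

Hypothesis rs_nonoverlapping : nonoverlapping.
Hypothesis rs_wf : all well_formed rs.

Lemma nonoverlapping_eq (r s : rule) (t u : nat -> tree) :
  r \in rs -> s \in rs -> inst t r.1 = inst u s.1 -> r = s.
Proof.
have /(pairwiseP (Leaf, Leaf)) disj := rs_nonoverlapping.
move=> /(nthP (Leaf, Leaf))[i lt_i <-] /(nthP (Leaf, Leaf))[j lt_j <-] E.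
have [ltij|ltji|->//] := ltngtP i j.
- by have := disj i j lt_i lt_j ltij; rewrite (inst_eq_overlap E).
- by have := disj j i lt_j lt_i ltji; rewrite (inst_eq_overlap (esym E)).
Qed.

Lemma root_step_functional (c d e : tree) :
  root_step c d -> root_step c e -> d = e.
Proof.
move=> [r [t [r_in -> ->]]] [s [u [s_in E ->]]].
have /andP[_ /allP sub] := allP rs_wf r r_in.
have Ers := nonoverlapping_eq r_in s_in E; rewrite -{}Ers in E *.
by apply/eq_in_inst => i /sub; move: i; apply/eq_in_inst.
Qed.

Lemma rewrites_stuck_unique (c d e : tree) :
  stuck d -> stuck e -> rewrites c d -> rewrites c e -> d = e.
Proof.
move=> std ste /clos_rt_rt1n_iff cd /clos_rt_rt1n_iff.
elim: cd std => {c d} [c|c c' d cc' _ IH] stc ce.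
  by case: ce stc => // c' e' cc' _ /stuck_root_step/(_ cc').
apply: IH => //; case: ce ste cc' => [/stuck_root_step ste /ste//|].
by move=> c'' e' cc'' c''e' _ /root_step_functional/(_ cc'')->.
Qed.

End Rewriting.

(** * The axiom system of a rewriting machine *)

Local Notation reach_dia := 0 (only parsing).
Local Notation diag_dia := 1 (only parsing).
Local Notation leaf_dia := 2 (only parsing).
Local Notation left_dia := 3 (only parsing).
Local Notation right_dia := 4 (only parsing).

Definition machine_dias : seq nat :=
  [:: reach_dia; diag_dia; leaf_dia; left_dia; right_dia].

Fixpoint spf_of (p : tree) : spf :=
  match p with
  | Var i => SVar i
  | Leaf => SDia leaf_dia STop
  | Node a b => SAnd (SDia left_dia (spf_of a)) (SDia right_dia (spf_of b))
  end.

Definition reached (p : tree) : spf := SDia reach_dia (spf_of p).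

Definition rule_ax (r : rule) : spi := (reached r.1, reached r.2).

Definition start_ax (c : tree) : spi := (STop, reached c).

Definition diag_ax : spi := (SDia diag_dia (SVar 0), SVar 0).

Definition expand_ax (h : tree) (r : nat) : spi :=
  (SAnd (reached h) (SVar 0), SDia r (SVar 0)).

Definition contract_ax (h : tree) (r : nat) : spi :=
  (SAnd (reached h) (SDia r (SVar 0)), SVar 0).

Definition machine_axs (rs : seq rule) (h : tree) : seq spi :=
  diag_ax :: map (expand_ax h) machine_dias ++
  map (contract_ax h) machine_dias ++ map rule_ax rs.

Definition run_axs (rs : seq rule) (h c : tree) : seq spi :=
  start_ax c :: machine_axs rs h.

Variant run_axs_spec (rs : seq rule) (h c : tree) : spi -> Prop :=
| RunStart : run_axs_spec rs h c (start_ax c)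
| RunDiag : run_axs_spec rs h c diag_ax
| RunExpand r of r \in machine_dias : run_axs_spec rs h c (expand_ax h r)
| RunContract r of r \in machine_dias : run_axs_spec rs h c (contract_ax h r)
| RunRule r of r \in rs : run_axs_spec rs h c (rule_ax r).

Lemma run_axsP (rs : seq rule) (h c : tree) (s : spi) :
  s \in run_axs rs h c <-> run_axs_spec rs h c s.
Proof.
rewrite in_cons in_cons !mem_cat; split.
  case/or4P=> [/eqP->|/eqP->|/mapP[r r_in ->]|/orP[]/mapP[r r_in ->]].
  - exact: RunStart.
  - exact: RunDiag.
  - exact: RunExpand.
  - exact: RunContract.
  - exact: RunRule.
by case=> [||r r_in|r r_in|r r_in]; rewrite ?eqxx ?map_f ?orbT.
Qed.

Lemma slo_eval_inst (A : SLO) (v : nat -> slo_car A) (t : nat -> tree)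
    (p : tree) :
  slo_eval (fun i => slo_eval v (spf_of (t i))) (spf_of p) =
  slo_eval v (spf_of (inst t p)).
Proof. by elim: p => //= a -> b ->. Qed.

Section DiagonalFrame.
Variable F : frame.
Hypothesis F_diag : forall r, r \in machine_dias ->
  forall w u, frel F r w u <-> w = u.
Implicit Types (V : nat -> world F -> Prop) (w : world F).

Lemma kr_sat_diagonal_dia V w (r : nat) (f : spf) :
  r \in machine_dias -> kr_sat V w (SDia r f) <-> kr_sat V w f.
Proof.
move=> r_in; split=> [[u [/(F_diag r_in)<-]]//|wf].
by exists w; split=> //; apply/F_diag.
Qed.

Lemma kr_sat_diagonal_spf_of V w (p : tree) :
  kr_sat V w (spf_of p) <-> forall i, i \in vars p -> V i w.
Proof.
elim: p => [i||a IHa b IHb].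
- by split=> [Vi j|]; [rewrite inE => /eqP->|apply; rewrite mem_head].
- by split=> // _; apply/kr_sat_diagonal_dia.
transitivity (kr_sat V w (SDia left_dia (spf_of a)) /\
              kr_sat V w (SDia right_dia (spf_of b))); first by split.
rewrite !kr_sat_diagonal_dia // IHa IHb /=.
split=> [[Va Vb] i|Vab]; first by rewrite mem_cat => /orP[/Va|/Vb].
by split=> i i_in; apply: Vab; rewrite mem_cat i_in ?orbT.
Qed.

Lemma kr_sat_diagonal_reached V w (p : tree) :
  kr_sat V w (reached p) <-> forall i, i \in vars p -> V i w.
Proof. by rewrite kr_sat_diagonal_dia //; apply: kr_sat_diagonal_spf_of. Qed.

Lemma diagonal_frame_validates (rs : seq rule) (h c : tree) :
  all well_formed rs -> ground c -> frame_validates F (run_axs rs h c).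
Proof.
move=> /allP rs_wf /nilP c_ground s /run_axsP[||r r_in|r r_in|r r_in] V w.
- by move=> _; apply/kr_sat_diagonal_reached; rewrite c_ground.
- by rewrite kr_sat_diagonal_dia.
- by case=> _; rewrite kr_sat_diagonal_dia.
- by case=> _ [u [/(F_diag r_in)<-]].
have /andP[_ /allP sub] := rs_wf r r_in.
move/kr_sat_diagonal_reached => Vr; apply/kr_sat_diagonal_reached => i /sub.
exact: Vr.
Qed.

End DiagonalFrame.

Section Halting.
Variables (rs : seq rule) (h c : tree).
Hypothesis run : rewrites rs c h.

Section HaltingSLO.
Variable A : SLO.
Hypothesis A_run : slo_validates A (run_axs rs h c).

Lemma rewrites_reached_le (v : nat -> slo_car A) (d e : tree) :
  rewrites rs d e -> slo_le (slo_eval v (reached d)) (slo_eval v (reached e)).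
Proof.
elim=> {d e} [d e [r [t [r_in -> ->]]]|d|d e f _ de _ ef].
- have r_ax : rule_ax r \in run_axs rs h c by apply/run_axsP/RunRule.
  have := A_run r_ax (fun i => slo_eval v (spf_of (t i))).
  by rewrite /= !slo_eval_inst.
- exact: slo_le_refl.
- exact: slo_le_trans de ef.
Qed.

Lemma halting_reached_top (v : nat -> slo_car A) :
  slo_eval v (reached h) = slo_top A.
Proof.
apply: slo_le_anti; first exact: slo_meetT.
apply: slo_le_trans (rewrites_reached_le v run).
exact/(A_run (s := start_ax c))/run_axsP/RunStart.
Qed.

Lemma halting_dia_id (r : nat) (x : slo_car A) :
  r \in machine_dias -> slo_dia r x = x.
Proof.
move=> r_in; have top_h := halting_reached_top (fun=> x).
have expand : expand_ax h r \in run_axs rs h c by apply/run_axsP/RunExpand.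
have contract : contract_ax h r \in run_axs rs h c.
  exact/run_axsP/RunContract.
move: (A_run expand (fun=> x)) (A_run contract (fun=> x)).
rewrite /expand_ax /contract_ax; move: (reached h) top_h => f /= ->.
by rewrite !slo_meet_top => x_le le_x; apply: slo_le_anti.
Qed.

End HaltingSLO.

Hypothesis rs_wf : all well_formed rs.
Hypothesis c_ground : ground c.

Lemma halting_complex : complex (run_axs rs h c).
Proof.
move=> A A_logic.
have A_run : slo_validates A (run_axs rs h c).
  by move=> s s_in; apply: A_logic => B; apply.
exists (element_frame A [in machine_dias]); split.
  apply/frame_validates_spi_logic/diagonal_frame_validates => // r r_in w u.
  by rewrite /= r_in.
by eexists; apply: element_frame_embedding => r x; apply: halting_dia_id.
Qed.

End Halting.

Definition diag_consequence : spi :=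
  (SAnd (SVar 0) (SDia diag_dia STop), SDia diag_dia (SVar 0)).

Lemma frame_valid_diag_ax_eq (F : frame) :
  frame_valid F diag_ax -> forall w u, frel F diag_dia w u -> w = u.
Proof. by move=> val w u wu; apply: (val (fun _ x => x = u)); exists u. Qed.

Lemma kr_conseq_diag (Sigma : seq spi) :
  diag_ax \in Sigma -> kr_conseq Sigma diag_consequence.
Proof.
move=> diag_in F /(_ _ diag_in)/frame_valid_diag_ax_eq diag V w [Vw [u [wu _]]].
by exists u; split=> //; rewrite -(diag w u wu).
Qed.

Section TreeSLO.
Variable reachable : tree -> Prop.

(* [◇₁] sends the whole set to itself and every other set to the empty one:
   it is deflationary, but unlike a subdiagonal [R₁] it is not a restriction. *)
Definition tree_dia (r : nat) (X : tree -> Prop) (c : tree) : Prop :=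
  match r, c with
  | reach_dia, _ => exists2 d, reachable d & X d
  | diag_dia, _ => forall d, X d
  | leaf_dia, Leaf => True
  | left_dia, Node a _ => X a
  | right_dia, Node _ b => X b
  | _, _ => False
  end.

Lemma tree_dia_mono (r : nat) (X Y : tree -> Prop) :
  (forall c, X c -> Y c) -> forall c, tree_dia r X c -> tree_dia r Y c.
Proof.
move=> XY c; case: r => [|[|[|[|[|r]]]]] //=.
- by case=> d d_reachable /XY; exists d.
- by move=> X_all d; apply: XY.
- by case: c => // a _; apply: XY.
- by case: c => // _ b; apply: XY.
Qed.

Definition tree_SLO : SLO := powerset_SLO tree_dia_mono.

Lemma tree_eval_inst (v : nat -> tree -> Prop) (t : nat -> tree) (p : tree) :
  (forall i, i \in vars p -> v i (t i)) ->
  @slo_eval tree_SLO v (spf_of p) (inst t p).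
Proof.
elim: p => //= [i vt|a IHa b IHb vt]; first by apply: vt; rewrite mem_head.
by split; [apply: IHa|apply: IHb] => i i_in; apply: vt;
  rewrite mem_cat i_in ?orbT.
Qed.

(* Linearity lets the matches of the two subtrees be glued: [v i] is an
   arbitrary set, so two occurrences of [Var i] could match different trees. *)
Lemma tree_eval_match (v : nat -> tree -> Prop) (p d : tree) :
  uniq (vars p) -> @slo_eval tree_SLO v (spf_of p) d ->
  exists2 t, d = inst t p & forall i, i \in vars p -> v i (t i).
Proof.
elim: p d => /= [i||a IHa b IHb] d.
- by move=> _ vd; exists (fun=> d) => // j; rewrite inE => /eqP->.
- by case: d => // _ _; exists Var.
rewrite cat_uniq => /and3P[ua /hasPn ab_disj ub].
case: d => [j|//|d e] [] //= /(IHa _ ua)[t -> vt] /(IHb _ ub)[u -> vu].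
exists (fun i => if i \in vars a then t i else u i) => [|i].
  congr Node; apply/eq_in_inst => i i_in; first by rewrite i_in.
  by rewrite ifN // ab_disj.
by rewrite mem_cat; case: ifP => [/vt//|_ /vu].
Qed.

End TreeSLO.

Section NonHalting.
Variables (rs : seq rule) (h c : tree).
Hypothesis rs_wf : all well_formed rs.
Hypotheses (h_ground : ground h) (c_ground : ground c).
Hypothesis no_run : ~ rewrites rs c h.

Let A := tree_SLO (rewrites rs c).

Lemma tree_SLO_unreached_halt (v : nat -> tree -> Prop) (w : tree) :
  ~ @slo_eval A v (reached h) w.
Proof.
case=> d cd /tree_eval_match[|t Ed _]; first by rewrite (nilP h_ground).
by rewrite Ed inst_ground in cd.
Qed.

Lemma tree_SLO_validates_run_axs : slo_validates A (run_axs rs h c).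
Proof.
move=> s /run_axsP[||r r_in|r r_in|r r_in] v; apply/powerset_SLO_le => w.
- move=> _; exists c; first exact: rt_refl.
  rewrite -[X in _ X]inst_Var.
  by apply: tree_eval_inst => i; rewrite (nilP c_ground).
- exact.
- by case=> /tree_SLO_unreached_halt.
- by case=> /tree_SLO_unreached_halt.
have /andP[lin /allP sub] := allP rs_wf r r_in.
case=> d cd /(tree_eval_match lin)[t Ed vt]; exists (inst t r.2).
  by apply: rt_trans cd _; apply: rt_step; exists r, t.
by apply: tree_eval_inst => i /sub/vt.
Qed.

Lemma tree_SLO_refutes_diag_consequence : ~ slo_valid A diag_consequence.
Proof.
move=> /(_ (fun _ d => d = Leaf))/powerset_SLO_le/(_ Leaf) /= all_leaf.
by have := all_leaf (conj erefl (fun=> I)) (Var 0).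
Qed.

Lemma nonhalting_incomplete : ~ complete (run_axs rs h c).
Proof.
case/(_ diag_consequence) => conseq _; apply: tree_SLO_refutes_diag_consequence.
apply: conseq tree_SLO_validates_run_axs; apply: kr_conseq_diag.
exact/run_axsP/RunDiag.
Qed.

End NonHalting.

(** * An interpreter for partial recursive functions *)

Definition suc (x : tree) : tree := Node Leaf x.
Definition num (n : nat) : tree := iter n suc Leaf.
Definition tlist (s : seq tree) : tree := foldr Node Leaf s.
Definition nums (s : seq nat) : tree := tlist (map num s).
Definition label (n : nat) (x : tree) : tree := Node (num n) x.

Definition zero_prog : tree := label 0 Leaf.
Definition succ_prog : tree := label 1 Leaf.
Definition proj_prog (i : tree) : tree := label 2 i.
Definition comp_prog (f gs : tree) : tree := label 3 (Node f gs).
Definition prim_prog (f g : tree) : tree := label 4 (Node f g).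
Definition mu_prog (f : tree) : tree := label 5 f.

Fixpoint prog (p : prf) : tree :=
  match p with
  | PZero => zero_prog
  | PSucc => succ_prog
  | PProj i => proj_prog (num i)
  | PComp f gs => comp_prog (prog f) (tlist (map prog gs))
  | PPrim f g => prim_prog (prog f) (prog g)
  | PMu f => mu_prog (prog f)
  end.

Definition eval (p a k : tree) : tree := label 0 (tlist [:: p; a; k]).
Definition reply (y k : tree) : tree := label 1 (tlist [:: y; k]).
Definition eval_list (gs a k : tree) : tree := label 2 (tlist [:: gs; a; k]).
Definition reply_list (ys k : tree) : tree := label 3 (tlist [:: ys; k]).
Definition start (x : tree) : tree := label 4 x.

Definition empty_cont : tree := Leaf.
Definition comp_cont (f k : tree) : tree := label 0 (tlist [:: f; k]).
Definition arg_cont (gs a k : tree) : tree := label 1 (tlist [:: gs; a; k]).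
Definition cons_cont (y k : tree) : tree := label 2 (tlist [:: y; k]).
Definition prim_cont (g n a k : tree) : tree := label 3 (tlist [:: g; n; a; k]).
Definition mu_cont (f n a k : tree) : tree := label 4 (tlist [:: f; n; a; k]).

Definition start_rule (P : tree) : rule :=
  let x := Var 0 in (start x, eval P (tlist [:: x]) empty_cont).

Definition zero_rule : rule :=
  let: (a, k) := (Var 0, Var 1) in
  (eval zero_prog a k, reply (num 0) k).

Definition succ_rule : rule :=
  let: (x, k) := (Var 0, Var 1) in
  (eval succ_prog (tlist [:: x]) k, reply (suc x) k).

Definition proj_head_rule : rule :=
  let: (x, a, k) := (Var 0, Var 1, Var 2) in
  (eval (proj_prog (num 0)) (Node x a) k, reply x k).

Definition proj_tail_rule : rule :=
  let: (i, x, a, k) := (Var 0, Var 1, Var 2, Var 3) in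
  (eval (proj_prog (suc i)) (Node x a) k, eval (proj_prog i) a k).

Definition comp_rule : rule :=
  let: (f, gs, a, k) := (Var 0, Var 1, Var 2, Var 3) in
  (eval (comp_prog f gs) a k, eval_list gs a (comp_cont f k)).

Definition comp_reply_rule : rule :=
  let: (f, ys, k) := (Var 0, Var 1, Var 2) in
  (reply_list ys (comp_cont f k), eval f ys k).

Definition nil_rule : rule :=
  let: (a, k) := (Var 0, Var 1) in
  (eval_list Leaf a k, reply_list Leaf k).

Definition cons_rule : rule :=
  let: (g, gs, a, k) := (Var 0, Var 1, Var 2, Var 3) in
  (eval_list (Node g gs) a k, eval g a (arg_cont gs a k)).

Definition arg_reply_rule : rule :=
  let: (y, gs, a, k) := (Var 0, Var 1, Var 2, Var 3) in
  (reply y (arg_cont gs a k), eval_list gs a (cons_cont y k)).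

Definition cons_reply_rule : rule :=
  let: (y, ys, k) := (Var 0, Var 1, Var 2) in
  (reply_list ys (cons_cont y k), reply_list (Node y ys) k).

Definition prim_zero_rule : rule :=
  let: (f, g, a, k) := (Var 0, Var 1, Var 2, Var 3) in
  (eval (prim_prog f g) (Node (num 0) a) k, eval f a k).

Definition prim_succ_rule : rule :=
  let: (f, g, n, a, k) := (Var 0, Var 1, Var 2, Var 3, Var 4) in
  (eval (prim_prog f g) (Node (suc n) a) k,
   eval (prim_prog f g) (Node n a) (prim_cont g n a k)).

Definition prim_reply_rule : rule :=
  let: (g, n, r, a, k) := (Var 0, Var 1, Var 2, Var 3, Var 4) in
  (reply r (prim_cont g n a k), eval g (Node n (Node r a)) k).

Definition mu_rule : rule :=
  let: (f, a, k) := (Var 0, Var 1, Var 2) in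
  (eval (mu_prog f) a k, eval f (Node (num 0) a) (mu_cont f (num 0) a k)).

Definition mu_found_rule : rule :=
  let: (f, n, a, k) := (Var 0, Var 1, Var 2, Var 3) in
  (reply (num 0) (mu_cont f n a k), reply n k).

Definition mu_next_rule : rule :=
  let: (f, n, y, a, k) := (Var 0, Var 1, Var 2, Var 3, Var 4) in
  (reply (suc y) (mu_cont f n a k),
   eval f (Node (suc n) a) (mu_cont f (suc n) a k)).

Definition rules (P : tree) : seq rule :=
  [:: start_rule P; zero_rule; succ_rule; proj_head_rule; proj_tail_rule;
      comp_rule; comp_reply_rule; nil_rule; cons_rule; arg_reply_rule;
      cons_reply_rule; prim_zero_rule; prim_succ_rule; prim_reply_rule;
      mu_rule; mu_found_rule; mu_next_rule].

Definition halt : tree := reply (num 0) empty_cont.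

Lemma ground_num (n : nat) : ground (num n).
Proof. by elim: n. Qed.

Lemma ground_label (n : nat) (x : tree) : ground (label n x) = ground x.
Proof. by rewrite ground_node ground_num. Qed.

Lemma ground_prog : forall p : prf, ground (prog p).
Proof.
fix IH 1 => -[||i|f gs|f g|f] //=; rewrite ground_label ?ground_node ?IH //.
  exact: ground_num.
by elim: gs => //= g gs IHgs; rewrite ground_node IH.
Qed.

Lemma rules_well_formed (P : tree) : ground P -> all well_formed (rules P).
Proof. by move=> /nilP P_ground; rewrite /= {1}/well_formed /= P_ground. Qed.

Lemma rules_nonoverlapping (P : tree) : nonoverlapping (rules P).
Proof. by []. Qed.

Section Simulation.
Variable P : tree.

Lemma rewrites_rule (r : rule) (s : seq tree) (d : tree) :
  r \in rules P -> rewrites (rules P) (inst (nth Leaf s) r.2) d ->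
  rewrites (rules P) (inst (nth Leaf s) r.1) d.
Proof. by move=> r_in; apply/rt_trans/rt_step; exists r, (nth Leaf s). Qed.

Local Ltac fire r s :=
  apply: (@rewrites_rule r s); first by rewrite !inE eqxx ?orbT.

Definition computes (p a y : tree) : Prop :=
  forall k, rewrites (rules P) (eval p a k) (reply y k).

Definition computes_list (gs a ys : tree) : Prop :=
  forall k, rewrites (rules P) (eval_list gs a k) (reply_list ys k).

Lemma computes_zero (a : tree) : computes zero_prog a (num 0).
Proof. by move=> k; fire zero_rule [:: a; k]; apply: rt_refl. Qed.

Lemma computes_succ (x : tree) : computes succ_prog (tlist [:: x]) (suc x).
Proof. by move=> k; fire succ_rule [:: x; k]; apply: rt_refl. Qed.

Lemma computes_proj (i : nat) (s : seq tree) :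
  i < size s -> computes (proj_prog (num i)) (tlist s) (nth Leaf s i).
Proof.
elim: s i => [|x s IHs] [|i] //= lt_i k.
  by fire proj_head_rule [:: x; tlist s; k]; apply: rt_refl.
by fire proj_tail_rule [:: num i; x; tlist s; k]; apply: IHs.
Qed.

Lemma computes_comp (f gs a ys y : tree) :
  computes_list gs a ys -> computes f ys y -> computes (comp_prog f gs) a y.
Proof.
move=> gs_ys f_y k; fire comp_rule [:: f; gs; a; k].
apply: rt_trans (gs_ys _) _; fire comp_reply_rule [:: f; ys; k].
exact: f_y.
Qed.

Lemma computes_nil (a : tree) : computes_list Leaf a Leaf.
Proof. by move=> k; fire nil_rule [:: a; k]; apply: rt_refl. Qed.

Lemma computes_cons (g gs a y ys : tree) :
  computes g a y -> computes_list gs a ys ->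
  computes_list (Node g gs) a (Node y ys).
Proof.
move=> g_y gs_ys k; fire cons_rule [:: g; gs; a; k].
apply: rt_trans (g_y _) _; fire arg_reply_rule [:: y; gs; a; k].
apply: rt_trans (gs_ys _) _; fire cons_reply_rule [:: y; ys; k].
exact: rt_refl.
Qed.

Lemma computes_prim_zero (f g a y : tree) :
  computes f a y -> computes (prim_prog f g) (Node (num 0) a) y.
Proof. by move=> f_y k; fire prim_zero_rule [:: f; g; a; k]; apply: f_y. Qed.

Lemma computes_prim_succ (f g n a r y : tree) :
  computes (prim_prog f g) (Node n a) r -> computes g (Node n (Node r a)) y ->
  computes (prim_prog f g) (Node (suc n) a) y.
Proof.
move=> prim_r g_y k; fire prim_succ_rule [:: f; g; n; a; k].
apply: rt_trans (prim_r _) _; fire prim_reply_rule [:: g; n; r; a; k].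
exact: g_y.
Qed.

Lemma computes_mu (f a : tree) (n : nat) :
  computes f (Node (num n) a) (num 0) ->
  (forall m, m < n -> exists y, computes f (Node (num m) a) (suc y)) ->
  computes (mu_prog f) a (num n).
Proof.
move=> f_n f_lt k; fire mu_rule [:: f; a; k].
suff search m : m <= n ->
    rewrites (rules P) (eval f (Node (num 0) a) (mu_cont f (num 0) a k))
                       (eval f (Node (num m) a) (mu_cont f (num m) a k)).
  apply: rt_trans (search n (leqnn n)) _; apply: rt_trans (f_n _) _.
  by fire mu_found_rule [:: f; num n; a; k]; apply: rt_refl.
elim: m => [_|m IHm lt_mn]; first exact: rt_refl.
apply: rt_trans (IHm (ltnW lt_mn)) _; have [y f_m] := f_lt m lt_mn.
apply: rt_trans (f_m _) _; fire mu_next_rule [:: f; num m; y; a; k].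
exact: rt_refl.
Qed.

Fixpoint peval_computes (p : prf) (a : seq nat) (y : nat) (p_y : peval p a y)
    {struct p_y} :
  computes (prog p) (nums a) (num y)
with pevals_computes (gs : seq prf) (a ys : seq nat) (gs_ys : pevals gs a ys)
    {struct gs_ys} :
  computes_list (tlist (map prog gs)) (nums a) (nums ys).
Proof.
- case: {p a y} p_y.
  + by move=> a; apply: computes_zero.
  + by move=> x; apply: computes_succ.
  + move=> i a lt_i; rewrite -(nth_map _ Leaf) //.
    by apply: computes_proj; rewrite size_map.
  + move=> f gs a ys y gs_ys f_y.
    exact: computes_comp (pevals_computes _ _ _ gs_ys)
                         (peval_computes _ _ _ f_y).
  + move=> f g a y f_y; exact: computes_prim_zero (peval_computes _ _ _ f_y).
  + move=> f g n a r y prim_r g_y.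
    exact: computes_prim_succ (peval_computes _ _ _ prim_r)
                              (peval_computes _ _ _ g_y).
  + move=> f a n f_n f_lt; apply: computes_mu (peval_computes _ _ _ f_n) _.
    move=> m /f_lt[y f_m]; exists (num y); exact: peval_computes _ _ _ f_m.
- case: {gs a ys} gs_ys => [a|g gs a y ys g_y gs_ys]; first exact: computes_nil.
  exact: computes_cons (peval_computes _ _ _ g_y) (pevals_computes _ _ _ gs_ys).
Qed.

Lemma start_rewrites (x : tree) :
  ground P -> rewrites (rules P) (start x) (eval P (tlist [:: x]) empty_cont).
Proof.
move=> P_ground; fire (start_rule P) [:: x]; rewrite /= inst_ground //.
exact: rt_refl.
Qed.

End Simulation.

Definition prog_axs (p : prf) : seq spi := machine_axs (rules (prog p)) halt.

Lemma peval_rewrites (p : prf) (n y : nat) :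
  peval p [:: n] y ->
  rewrites (rules (prog p)) (start (num n)) (reply (num y) empty_cont).
Proof.
move=> p_y; apply: rt_trans (start_rewrites _ (ground_prog p)) _.
exact: (peval_computes _ p_y).
Qed.

Lemma peval0_complex (p : prf) (n : nat) :
  peval p [:: n] 0 -> complex (start_ax (start (num n)) :: prog_axs p).
Proof.
move=> /peval_rewrites p_0; apply: halting_complex p_0 _ _.
  exact/rules_well_formed/ground_prog.
by rewrite ground_label ground_num.
Qed.

Lemma pevalS_incomplete (p : prf) (n y : nat) :
  peval p [:: n] y.+1 -> ~ complete (start_ax (start (num n)) :: prog_axs p).
Proof.
move=> /peval_rewrites p_y; have wf := rules_well_formed (ground_prog p).
apply: nonhalting_incomplete => //; first by rewrite ground_label ground_num.
move=> p_halt; have nov := rules_nonoverlapping (prog p).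
by have /(_ isT isT) := rewrites_stuck_unique nov wf _ _ p_y p_halt.
Qed.

(** * Computing the code of the axiom system *)

Definition computable (f : nat -> nat) : Prop :=
  exists p, forall x, peval p [:: x] (f x).

Lemma eq_computable (f g : nat -> nat) : f =1 g -> computable f -> computable g.
Proof. by move=> fg [p p_f]; exists p => x; rewrite -fg. Qed.

Lemma computable_id : computable id.
Proof. by exists (PProj 0) => x; apply: (@ev_proj 0 [:: x]). Qed.

Lemma computable_comp (f g : nat -> nat) :
  computable f -> computable g -> computable (f \o g).
Proof.
move=> [p p_f] [q q_g]; exists (PComp p [:: q]) => x.
exact: ev_comp (evs_cons (q_g x) (evs_nil _)) (p_f _).
Qed.

Lemma computable_succ : computable S.
Proof. by exists PSucc; apply: ev_succ. Qed.

Lemma computable_const (c : nat) : computable (fun=> c).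
Proof.
elim: c => [|c IHc]; first by exists PZero => x; apply: ev_zero.
exact: computable_comp computable_succ IHc.
Qed.

Lemma computable_iter (f m s : nat -> nat) :
  computable f -> computable m -> computable s ->
  computable (fun x => iter (m x) f (s x)).
Proof.
move=> [p p_f] [q q_m] [r r_s].
exists (PComp (PPrim (PProj 0) (PComp p [:: PProj 1])) [:: q; r]) => x.
apply: ev_comp (evs_cons (q_m x) (evs_cons (r_s x) (evs_nil _))) _.
elim: (m x) => [|n IHn] /=; first exact/ev_prim0/(@ev_proj 0 [:: s x]).
apply: ev_primS IHn _; apply: ev_comp (p_f _).
by apply: evs_cons (evs_nil _); apply: (@ev_proj 1 [:: _; _; _]).
Qed.

Lemma computable_double : computable double.
Proof.
apply: (@eq_computable (fun x => iter x (S \o S) 0)); first by elim=> //= n ->.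
apply: computable_iter computable_id (computable_const 0).
exact: computable_comp computable_succ computable_succ.
Qed.

Definition code_cons (n m : nat) : nat := 2 ^ n * m.*2.+1.

Definition code_cat (s : seq nat) (m : nat) : nat := foldr code_cons m s.

Lemma code_code_cat (s t : seq nat) :
  CodeSeq.code (s ++ t) = code_cat s (CodeSeq.code t).
Proof. exact: foldr_cat. Qed.

Lemma code_cat_flatten_nseq (n : nat) (s : seq nat) (m : nat) :
  code_cat (flatten (nseq n s)) m = iter n (code_cat s) m.
Proof. by elim: n => //= n <-; apply: foldr_cat. Qed.

Lemma computable_code_cons (f g : nat -> nat) :
  computable f -> computable g -> computable (fun x => code_cons (f x) (g x)).
Proof.
move=> f_comp g_comp.
apply: (@eq_computable (fun x => iter (f x) double (g x).*2.+1)) => [x|].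
  rewrite /code_cons; elim: (f x) => [|n /= ->]; first by rewrite mul1n.
  by rewrite expnS -mulnA mul2n.
apply: computable_iter computable_double f_comp _.
apply: computable_comp computable_succ _.
exact: computable_comp computable_double g_comp.
Qed.

Lemma computable_code_cat (s : seq nat) (f : nat -> nat) :
  computable f -> computable (fun x => code_cat s (f x)).
Proof.
move=> f_comp; elim: s => [|n s IHs] //.
exact: computable_code_cons (computable_const n) IHs.
Qed.

Lemma computable_code_cat_nseq (s : seq nat) (m f : nat -> nat) :
  computable m -> computable f ->
  computable (fun x => code_cat (flatten (nseq (m x) s)) (f x)).
Proof.
move=> m_comp f_comp.
apply: (eq_computable (fun x => esym (code_cat_flatten_nseq (m x) s (f x)))).
apply: computable_iter m_comp f_comp.
exact: computable_code_cat computable_id.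
Qed.

Definition tokens (f : spf) : seq nat :=
  map pickle (GenTree.encode (spf_to_tree f)).

Definition open_token (k : nat) : nat := pickle (inl k.+1 : nat + nat).
Definition close_token : nat := pickle (inl 0 : nat + nat).
Definition leaf_token (n : nat) : nat := pickle (inr n : nat + nat).

Lemma pickle_spf (f : spf) : pickle f = CodeSeq.code (tokens f).
Proof. by []. Qed.

Lemma tokens_SAnd (f g : spf) :
  tokens (SAnd f g) = open_token 2 :: tokens f ++ tokens g ++ [:: close_token].
Proof. by rewrite /tokens /= cats0 map_rcons -cats1 map_cat catA. Qed.

Lemma tokens_SDia (r : nat) (f : spf) :
  tokens (SDia r f) =
  [:: open_token 3, leaf_token r & tokens f ++ [:: close_token]].
Proof. by rewrite /tokens /= cats0 map_rcons -cats1. Qed.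

Definition node_prefix (a : tree) : seq nat :=
  open_token 2 :: tokens (SDia left_dia (spf_of a)) ++
  [:: open_token 3; leaf_token right_dia].

Definition node_suffix : seq nat := [:: close_token; close_token].

Lemma tokens_spf_of_node (a b : tree) :
  tokens (spf_of (Node a b)) =
  node_prefix a ++ tokens (spf_of b) ++ node_suffix.
Proof.
rewrite tokens_SAnd [tokens (SDia right_dia _)]tokens_SDia /node_prefix.
by rewrite !cat_cons -!catA.
Qed.

Lemma flatten_nseqSr (T : Type) (n : nat) (s : seq T) :
  flatten (nseq n.+1 s) = flatten (nseq n s) ++ s.
Proof. by rewrite -addn1 nseqD flatten_cat /= cats0. Qed.

Lemma tokens_num (n : nat) :
  tokens (spf_of (num n)) =
  flatten (nseq n (node_prefix Leaf)) ++ tokens (spf_of Leaf) ++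
  flatten (nseq n node_suffix).
Proof.
elim: n => [|n IHn]; first by rewrite cats0.
by rewrite tokens_spf_of_node IHn (flatten_nseqSr n node_suffix) -!catA.
Qed.

Definition start_prefix : seq nat :=
  [:: open_token 3, leaf_token reach_dia & node_prefix (num 4)].

Definition start_suffix : seq nat := node_suffix ++ [:: close_token].

Lemma tokens_reached_start (x : tree) :
  tokens (reached (start x)) =
  start_prefix ++ tokens (spf_of x) ++ start_suffix.
Proof. by rewrite tokens_SDia tokens_spf_of_node !cat_cons -!catA. Qed.

Lemma pickle_reached_start_num (n : nat) :
  pickle (reached (start (num n))) =
  code_cat start_prefix
    (code_cat (flatten (nseq n (node_prefix Leaf)))
      (code_cat (tokens (spf_of Leaf))
        (code_cat (flatten (nseq n node_suffix)) (CodeSeq.code start_suffix)))).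
Proof.
by rewrite pickle_spf tokens_reached_start tokens_num -!catA !code_code_cat.
Qed.

Lemma computable_pickle_reached_start :
  computable (fun n => pickle (reached (start (num n)))).
Proof.
apply: (eq_computable (fun n => esym (pickle_reached_start_num n))).
apply/computable_code_cat/(computable_code_cat_nseq _ computable_id).
apply/computable_code_cat/(computable_code_cat_nseq _ computable_id).
exact: computable_const.
Qed.

Lemma pickle_spi (f g : spf) :
  pickle ((f, g) : spi) = code_cons (pickle f) (code_cons (pickle g) 0).
Proof. by []. Qed.

Lemma pickle_spi_cons (i : spi) (s : seq spi) :
  pickle (i :: s) = code_cons (pickle i) (pickle s).
Proof. by []. Qed.

Lemma computable_pickle_start_ax :
  computable (fun n => pickle (start_ax (start (num n)))).
Proof.
apply: (eq_computable (fun n => esym (pickle_spi STop (reached _)))).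
apply: computable_code_cons; first exact: computable_const.
apply: computable_code_cons computable_pickle_reached_start _.
exact: computable_const.
Qed.

(* The input given to the machine is the code of its own axioms other than the
   initial one, so that prepending the latter is an arithmetic operation. *)
Lemma undecidable_between_complex_complete (Q : seq spi -> Prop) :
  (forall Sigma, complex Sigma -> Q Sigma) ->
  (forall Sigma, Q Sigma -> complete Sigma) ->
  ~ rec_decidable Q.
Proof.
move=> complex_Q Q_complete [p p_decides].
have [q q_start] :=
  computable_code_cons computable_pickle_start_ax computable_id.
pose d := PComp p [:: q].
pose Sigma n := start_ax (start (num n)) :: prog_axs d.
pose e := pickle (prog_axs d).
have d_e y : peval p [:: pickle (Sigma e)] y -> peval d [:: e] y.
  rewrite pickle_spi_cons.
  exact: ev_comp (evs_cons (q_start e) (evs_nil _)).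
have nQ : ~ Q (Sigma e).
  by move=> /[dup] /(p_decides _).1 /d_e /pevalS_incomplete inc /Q_complete.
by apply: (nQ); apply/complex_Q/peval0_complex/d_e/(p_decides _).2.
Qed.

Theorem theorem8p1 :
  ~ rec_decidable (fun Sigma : seq spi => complete Sigma) /\
  ~ rec_decidable (fun Sigma : seq spi => complex Sigma).
Proof.
by split; apply: undecidable_between_complex_complete => // Sigma;
  apply: complex_complete.
Qed.
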